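(* Let $N,K$ be positive integers, let $\mathcal{X}\subseteq\mathbb{R}^N$ be convex and compact, let $f,g_1,\dots,g_K:\mathcal{X}\to\mathbb{R}$ be continuous and convex, and let $c_1,\dots,c_K\in\mathbb{R}$. Consider the convex program: minimize $f(x)$ subject to $g_k(x)\le c_k$ for all $k\in\{1,\dots,K\}$ and $x\in\mathcal{X}$. Suppose that it is feasible, with optimal solution $x^*$ and optimal value $f^*=f(x^* )$, and that there is a vector $(\mu_1,\dots,\mu_K)$ with non-negative components (a Lagrange multiplier vector) such that $$f(x)+\sum_{k=1}^K\mu_k g_k(x)\;\ge\; f(x^* )+\sum_{k=1}^K\mu_k c_k\qquad\text{for all }x\in\mathcal{X}.$$ Fix $\epsilon>0$, let $\{x(t)\}_{t=0}^\infty$ be the (deterministic) sequence produced by the drift-plus-penalty algorithm for convex programs (defined in the context) with $V=1/\epsilon$, and let $\overline{x}(t)=\frac1t\sum_{\tau=0}^{t-1}x(\tau)$ for $t>0$. Then $\overline{x}(t)\in\mathcal{X}$ for all integers $t>0$, and for all integers $t\ge 1/\epsilon^2$, $$f(\overline{x}(t))\le f^*+O(\epsilon),\qquad g_k(\overline{x}(t))\le c_k+O(\epsilon)\quad\text{for all }k\in\{1,\dots,K\}.$$ That is, the algorithm produces an $O(\epsilon)$ approximation to the convex program with convergence time $O(1/\epsilon^2)$. Here $O(\epsilon)$ denotes a quantity bounded by $C\epsilon$, where $C$ is a finite constant that does not depend on $\epsilon$ or $t$.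
   Context: Drift-plus-penalty algorithm for convex programs, with parameter $V>0$. Initialize $Q_k(0)=0$ for all $k\in\{1,\dots,K\}$. On every slot $t\in\{0,1,2,\dots\}$: observe $(Q_1(t),\dots,Q_K(t))$ and choose $x(t)\in\mathcal{X}$ that minimizes $$Vf(x(t))+\sum_{k=1}^KQ_k(t)g_k(x(t))$$ over $\mathcal{X}$, with ties broken by some deterministic method; then update $Q_k(t+1)=\max[Q_k(t)+g_k(x(t))-c_k,\,0]$ for each $k\in\{1,\dots,K\}$. *)

(* Defs.v *)
From HB Require Import structures.
From mathcomp Require Import all_boot all_order all_algebra.
From mathcomp Require Import all_classical all_reals all_analysis.
Import Order.TTheory GRing.Theory Num.Theory.
Import numFieldNormedType.Exports.

Set Implicit Arguments.
Unset Strict Implicit.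
Unset Printing Implicit Defensive.

Local Open Scope classical_set_scope.
Local Open Scope ring_scope.

Definition minimizes_on (R : realType) (T : Type) (A : set T) (h : T -> R)
    (x : T) : Prop :=
  A x /\ forall y, A y -> h x <= h y.

Definition feasible_set (R : realType) (N K : nat) (X : set 'rV[R]_N)
    (g : 'I_K -> 'rV[R]_N -> R) (c : 'I_K -> R) : set 'rV[R]_N :=
  [set x | X x /\ forall k, g k x <= c k].

(* A trajectory of the drift-plus-penalty algorithm: decisions [x t] and
   virtual queues [Q t k].  Ties between minimizers are unconstrained, so every
   tie-breaking method (even a history-dependent one) yields such a
   trajectory. *)
Definition dpp_trajectory (R : realType) (N K : nat) (X : set 'rV[R]_N)
    (f : 'rV[R]_N -> R) (g : 'I_K -> 'rV[R]_N -> R) (c : 'I_K -> R) (V : R)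
    (x : nat -> 'rV[R]_N) (Q : nat -> 'I_K -> R) : Prop :=
  [/\ forall k, Q 0%N k = 0,
      forall t, minimizes_on X
        (fun y => V * f y + \sum_(k < K) Q t k * g k y) (x t)
    & forall t k, Q t.+1 k = Num.max (Q t k + g k (x t) - c k) 0].

(* Only meaningful for [0 < t]. *)
Definition time_average (R : realType) (N : nat) (x : nat -> 'rV[R]_N)
    (t : nat) : 'rV[R]_N :=
  t%:R^-1 *: \sum_(0 <= tau < t) x tau.

(* Main.v *)
Require Import Defs.
From HB Require Import structures.
From mathcomp Require Import all_boot all_order all_algebra.
From mathcomp Require Import all_classical all_reals all_analysis.
From mathcomp Require Import ring lra.
Import Order.TTheory GRing.Theory Num.Theory.
Import numFieldNormedType.Exports.

Set Implicit Arguments.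
Unset Strict Implicit.

Local Open Scope classical_set_scope.
Local Open Scope ring_scope.

(** The drift of [L t = \sum_k Q t k ^+ 2] is bounded using that [x t] is at
    least as good as [xstar] in the minimized expression; telescoping gives
    [L t + 2 V \sum_(tau < t) f (x tau) <= t (D + 2 V f xstar)], where [D]
    bounds [\sum_k (g k - c k) ^+ 2] on the compact set [X].  Jensen's
    inequality yields the objective bound.  For the constraints,
    [\sum_(tau < t) (g k (x tau) - c k) <= Q t k], so the Lagrange inequality
    bounds [\sum_(tau < t) f (x tau)] from below by
    [t f xstar - \sum_k mu k Q t k]; hence [L t] is at most
    [2 t D + 4 V^2 |mu|^2 = O(t)] once [V^2 <= t], and
    [Q t k / t = O(1 / sqrt t) = O(eps)]. *)

Lemma convex_setD (R : realType) (N : nat) (A : set 'rV[R]_N) (p : R)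
    (x y : 'rV[R]_N) :
  convex_set A -> 0 <= p -> p <= 1 -> A x -> A y ->
  A (p *: x + (1 - p) *: y).
Proof.
move=> cA p0 p1 Ax Ay; apply/set_mem.
by apply: (cA x y (Itv01 p0 p1)); exact/mem_set.
Qed.

Lemma convex_functionD (R : realType) (N : nat) (A : set 'rV[R]_N)
    (h : 'rV[R]_N -> R) (p : R) (x y : 'rV[R]_N) :
  convex_function A h -> 0 <= p -> p <= 1 -> A x -> A y ->
  h (p *: x + (1 - p) *: y) <= p * h x + (1 - p) * h y.
Proof.
move=> ch p0 p1 Ax Ay.
by apply: (ch (Itv01 p0 p1) x y); exact/mem_set.
Qed.

(* At [t = 0] the junk value [time_average x 0] has weight [0]. *)
Lemma time_averageS (R : realType) (N : nat) (x : nat -> 'rV[R]_N) (t : nat) :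
  time_average x t.+1 =
  (t%:R / t.+1%:R) *: time_average x t + (1 - t%:R / t.+1%:R) *: x t.
Proof.
have t1 : t.+1%:R != 0 :> R by rewrite pnatr_eq0.
have -> : 1 - t%:R / t.+1%:R = t.+1%:R^-1 :> R.
  by rewrite -[X in X - _](divff t1) -mulrBl -natr1 addrAC subrr add0r mul1r.
rewrite /time_average big_nat_recr//= scalerDr; congr (_ + _).
case: t t1 => [|t] t1; first by rewrite big_geq// !scaler0.
by rewrite scalerA mulrAC divff ?mul1r// pnatr_eq0.
Qed.

Lemma time_average_weight (R : realType) (t : nat) :
  0 <= (t%:R / t.+1%:R : R) <= 1.
Proof.
by rewrite divr_ge0//= ler_pdivrMr ?ltr0n// mul1r ler_nat.
Qed.

(** By [time_averageS] each average is a two-point convex combination of the previous average and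
    the newest point, so binary convexity suffices by induction. *)
Lemma convex_time_average (R : realType) (N : nat) (A : set 'rV[R]_N)
    (x : nat -> 'rV[R]_N) :
  convex_set A -> (forall t, A (x t)) ->
  forall t, (0 < t)%N -> A (time_average x t).
Proof.
move=> cA Ax; case=> // t _; elim: t => [|t IH].
  by rewrite time_averageS mul0r subr0 scale0r add0r scale1r.
rewrite time_averageS; have /andP[w0 w1] := @time_average_weight R t.+1.
exact: convex_setD.
Qed.

Lemma time_average_Jensen (R : realType) (N : nat) (A : set 'rV[R]_N)
    (h : 'rV[R]_N -> R) (x : nat -> 'rV[R]_N) :
  convex_set A -> convex_function A h -> (forall t, A (x t)) ->
  forall t, (0 < t)%N ->
  t%:R * h (time_average x t) <= \sum_(0 <= tau < t) h (x tau).
Proof.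
move=> cA ch Ax; case=> // t _; elim: t => [|t IH].
  rewrite time_averageS mul0r subr0 scale0r add0r scale1r mul1r.
  by rewrite big_nat1.
rewrite time_averageS big_nat_recr//=.
have /andP[w0 w1] := @time_average_weight R t.+1.
have := convex_functionD ch w0 w1 (convex_time_average cA Ax (ltn0Sn t))
  (Ax t.+1).
move=> /(ler_wpM2l (ler0n R t.+2)) /le_trans; apply.
have -> : forall a b : R, t.+2%:R * (t.+1%:R / t.+2%:R * a +
    (1 - t.+1%:R / t.+2%:R) * b) = t.+1%:R * a + b.
  move=> a b; have t2 : t.+2%:R != 0 :> R by rewrite pnatr_eq0.
  by rewrite -[t.+2%:R]natr1 in t2 *; field.
by rewrite lerD2r.
Qed.

Lemma compact_continuous_sqr_bound (R : realType) (N : nat)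
    (A : set 'rV[R]_N) (h : 'rV[R]_N -> R) (a : R) :
  compact A -> {within A, continuous h} ->
  exists D : R, forall x, A x -> (h x - a) ^+ 2 <= D.
Proof.
move=> cA ch.
have /compact_bounded[M [_ hM]] := continuous_compact ch cA.
exists ((M + 1 + `|a|) ^+ 2) => x Ax.
(* [hM] bounds the image only by numbers strictly above [M], hence [M + 1]. *)
have hx : `|h x| <= M + 1 by apply: (hM (M + 1)); [rewrite ltrDl|exists x].
rewrite -[_ ^+ 2]real_normK ?num_real// ler_sqr ?nnegrE//.
  by apply: le_trans (ler_normB _ _) _; rewrite lerD2r.
by rewrite addr_ge0// (le_trans _ hx).
Qed.

Lemma dpp_queue_ge0 (R : realType) (N K : nat) (X : set 'rV[R]_N)
    (f : 'rV[R]_N -> R) (g : 'I_K -> 'rV[R]_N -> R) (c : 'I_K -> R) (V : R)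
    (x : nat -> 'rV[R]_N) (Q : nat -> 'I_K -> R) :
  dpp_trajectory X f g c V x Q -> forall t k, 0 <= Q t k.
Proof.
case=> Q0 _ QS [|t] k; first by rewrite Q0.
by rewrite QS le_max lexx orbT.
Qed.

(** Each update dominates [Q t k + g k (x t) - c k]; telescope from the empty queue. *)
Lemma dpp_queue_ge_sum (R : realType) (N K : nat) (X : set 'rV[R]_N)
    (f : 'rV[R]_N -> R) (g : 'I_K -> 'rV[R]_N -> R) (c : 'I_K -> R) (V : R)
    (x : nat -> 'rV[R]_N) (Q : nat -> 'I_K -> R) :
  dpp_trajectory X f g c V x Q ->
  forall t k, \sum_(0 <= tau < t) g k (x tau) <= t%:R * c k + Q t k.
Proof.
case=> Q0 _ QS t k; elim: t => [|t IH].
  by rewrite big_geq// Q0 mul0r addr0.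
rewrite big_nat_recr//= QS -natr1.
have : Q t k + g k (x t) - c k <= Num.max (Q t k + g k (x t) - c k) 0.
  by rewrite le_max lexx.
by lra.
Qed.

(** Squaring the update uses [max(a, 0)^2 <= a^2]. The sum of [Q t k * g k (x t)] stays separate
    because it is the queue part of the minimized expression. *)
Lemma dpp_drift (R : realType) (N K : nat) (X : set 'rV[R]_N)
    (f : 'rV[R]_N -> R) (g : 'I_K -> 'rV[R]_N -> R) (c : 'I_K -> R) (V : R)
    (x : nat -> 'rV[R]_N) (Q : nat -> 'I_K -> R) :
  dpp_trajectory X f g c V x Q -> forall t,
  \sum_(k < K) Q t.+1 k ^+ 2 <=
  \sum_(k < K) Q t k ^+ 2 + \sum_(k < K) (g k (x t) - c k) ^+ 2 +
  2 * (\sum_(k < K) Q t k * g k (x t) - \sum_(k < K) Q t k * c k).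
Proof.
case=> _ _ QS t; rewrite -sumrB mulr_sumr -!big_split/=.
apply: ler_sum => k _; rewrite QS.
set q := Q t k; set d := g k (x t).
have -> : q ^+ 2 + (d - c k) ^+ 2 + 2 * (q * d - q * c k) = (q + d - c k) ^+ 2.
  by ring.
by have [_|_] := leP (q + d - c k) 0; rewrite ?expr0n ?sqr_ge0.
Qed.

(** Comparing [x t] with a feasible [z] cancels the queue terms of the drift, since nonnegative
    queues preserve [g k z <= c k]. The factor [2 * V] matches the factor 2 in the drift. *)
Lemma dpp_objective_sum (R : realType) (N K : nat) (X : set 'rV[R]_N)
    (f : 'rV[R]_N -> R) (g : 'I_K -> 'rV[R]_N -> R) (c : 'I_K -> R) (V D : R)
    (x : nat -> 'rV[R]_N) (Q : nat -> 'I_K -> R) (z : 'rV[R]_N) :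
  dpp_trajectory X f g c V x Q -> feasible_set X g c z ->
  (forall y, X y -> \sum_(k < K) (g k y - c k) ^+ 2 <= D) ->
  forall t, \sum_(k < K) Q t k ^+ 2 +
      2 * V * (\sum_(0 <= tau < t) f (x tau)) <=
    t%:R * (D + 2 * V * f z).
Proof.
move=> dpp [Xz gz] hD; elim=> [|t IH].
  rewrite big_geq// mulr0 addr0 mul0r big1// => k _.
  by case: dpp => -> _ _; rewrite expr0n.
have Q_ge0 := dpp_queue_ge0 dpp.
have drift := dpp_drift dpp t.
case: dpp => _ /(_ t)[Xx /(_ z Xz) xmin] _.
have Qz : \sum_(k < K) Q t k * g k z <= \sum_(k < K) Q t k * c k.
  by apply: ler_sum => k _; exact: ler_wpM2l.
have := hD _ Xx; rewrite big_nat_recr//= -natr1; lra.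
Qed.

Lemma dpp_queue_bound (R : realType) (N K : nat) (X : set 'rV[R]_N)
    (f : 'rV[R]_N -> R) (g : 'I_K -> 'rV[R]_N -> R) (c : 'I_K -> R) (V D : R)
    (x : nat -> 'rV[R]_N) (Q : nat -> 'I_K -> R) (z : 'rV[R]_N)
    (mu : 'I_K -> R) :
  0 <= V -> dpp_trajectory X f g c V x Q -> feasible_set X g c z ->
  (forall y, X y -> \sum_(k < K) (g k y - c k) ^+ 2 <= D) ->
  (forall k, 0 <= mu k) ->
  (forall y, X y ->
     f z + \sum_(k < K) mu k * c k <= f y + \sum_(k < K) mu k * g k y) ->
  forall t, \sum_(k < K) Q t k ^+ 2 <=
    2 * t%:R * D + 4 * V ^+ 2 * \sum_(k < K) mu k ^+ 2.
Proof.
move=> V0 dpp hz hD mu0 lagr t.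
have Xx t' : X (x t') by case: dpp => _ /(_ t')[].
have lower : t%:R * f z - \sum_(k < K) mu k * Q t k <=
    \sum_(0 <= tau < t) f (x tau).
  have : t%:R * (f z + \sum_(k < K) mu k * c k) <=
      \sum_(0 <= tau < t) (f (x tau) + \sum_(k < K) mu k * g k (x tau)).
    (* The left side becomes a constant sum over the slots, ready for termwise comparison. *)
    rewrite mulr_natl -[X in _ *+ X]subn0 -sumr_const_nat.
    by apply: ler_sum => tau _; exact: lagr.
  rewrite big_split/= exchange_big/=.
  under [X in _ <= _ + X]eq_bigr do rewrite -mulr_sumr.
  have : \sum_(k < K) mu k * \sum_(0 <= tau < t) g k (x tau) <=
      \sum_(k < K) mu k * (t%:R * c k + Q t k).
    apply: ler_sum => k _; apply: ler_wpM2l => //.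
    exact: (dpp_queue_ge_sum dpp).
  have -> : \sum_(k < K) mu k * (t%:R * c k + Q t k) =
      t%:R * (\sum_(k < K) mu k * c k) + \sum_(k < K) mu k * Q t k.
    by rewrite mulr_sumr -big_split/=; apply: eq_bigr => k _; ring.
  lra.
have := dpp_objective_sum dpp hz hD t.
have : 2 * V * (t%:R * f z - \sum_(k < K) mu k * Q t k) <=
    2 * V * \sum_(0 <= tau < t) f (x tau).
  by apply: ler_wpM2l => //; rewrite mulr_ge0.
(* AM-GM absorbs half of the squared queue length. *)
have : 2 * V * (\sum_(k < K) mu k * Q t k) <=
    2 * V ^+ 2 * (\sum_(k < K) mu k ^+ 2) + 2^-1 * \sum_(k < K) Q t k ^+ 2.
  rewrite !mulr_sumr -big_split/=; apply: ler_sum => k _.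
  have := sqr_ge0 (2 * V * mu k - Q t k); lra.
(* Half of the squared queue length remains on the left; doubling produces the constants 2 and 4. *)
lra.
Qed.

Theorem mainTheorem2 (R : realType) (N K : nat) (hN : (0 < N)%N) (hK : (0 < K)%N)
    (X : set 'rV[R]_N) (hXconvex : convex_set X) (hXcompact : compact X)
    (f : 'rV[R]_N -> R) (g : 'I_K -> 'rV[R]_N -> R) (c : 'I_K -> R)
    (hfcont : {within X, continuous f})
    (hfconvex : convex_function X f)
    (hgcont : forall k, {within X, continuous (g k)})
    (hgconvex : forall k, convex_function X (g k))
    (xstar : 'rV[R]_N)
    (hxstar : minimizes_on (feasible_set X g c) f xstar)
    (mu : 'I_K -> R) (hmu : forall k, 0 <= mu k)
    (hlagrange : forall x, X x ->
       f xstar + \sum_(k < K) mu k * c k <= f x + \sum_(k < K) mu k * g k x) :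
  exists C : R, forall (eps : R), 0 < eps ->
    forall (x : nat -> 'rV[R]_N) (Q : nat -> 'I_K -> R),
      dpp_trajectory X f g c (1 / eps) x Q ->
      (forall t : nat, (0 < t)%N -> X (time_average x t)) /\
      (forall t : nat, 1 / eps ^+ 2 <= t%:R ->
         f (time_average x t) <= f xstar + C * eps /\
         forall k, g k (time_average x t) <= c k + C * eps).
Proof.
have [D hD] : exists D : R,
    forall y, X y -> \sum_(k < K) (g k y - c k) ^+ 2 <= D.
  have /choice[D hD] : forall k, exists D : R,
      forall y, X y -> (g k y - c k) ^+ 2 <= D.
    by move=> k; exact: compact_continuous_sqr_bound.
  by exists (\sum_(k < K) D k) => y Xy; apply: ler_sum => k _; exact: hD.
have [[Xstar gstar] _] := hxstar.
have D0 : 0 <= D.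
  by apply: le_trans (hD _ Xstar); apply: sumr_ge0 => k _; exact: sqr_ge0.
pose M := \sum_(k < K) mu k ^+ 2.
have M0 : 0 <= M by apply: sumr_ge0 => k _; exact: sqr_ge0.
(* [2 * D + 4 * M] comes from [dpp_queue_bound] with [V ^+ 2 <= t]. The extra 1 gives [C <= C ^+ 2],
   which replaces a square root. *)
exists (1 + 2 * D + 4 * M) => eps eps0 x Q dpp.
have Xx t : X (x t) by case: dpp => _ /(_ t)[].
split=> [|t teps]; first exact: convex_time_average.
have t0 : 0 < t%:R :> R by apply: lt_le_trans teps; rewrite divr_gt0 ?exprn_gt0.
have tn0 : (0 < t)%N by rewrite -(ltr0n R).
have V0 : 0 <= 1 / eps by rewrite divr_ge0// ltW.
have Vt : (1 / eps) ^+ 2 <= t%:R by rewrite expr_div_n expr1n.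
have epst : 1 <= t%:R * eps ^+ 2.
  by rewrite -ler_pdivrMr ?exprn_gt0.
have C0 : 1 <= 1 + 2 * D + 4 * M by lra.
split.
  have J := time_average_Jensen hXconvex hfconvex Xx tn0.
  have := dpp_objective_sum dpp (conj Xstar gstar) hD t.
  have Q0 : 0 <= \sum_(k < K) Q t k ^+ 2.
    by apply: sumr_ge0 => k _; exact: sqr_ge0.
  have := ler_wpM2l V0 J.
  set F := f _; set S := \sum_(0 <= _ < t) _ => VJ obj.
  (* Drop the nonnegative squared queues; cancelling [t] and multiplying by [eps] then leaves an
     error of [eps * D / 2]. *)
  have : t%:R * (2 * (1 / eps) * F) <= t%:R * (D + 2 * (1 / eps) * f xstar).
    by lra.
  rewrite ler_pM2l// -(ler_pM2l eps0).
  have -> : eps * (2 * (1 / eps) * F) = 2 * F by field; rewrite gt_eqF.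
  have -> : eps * (D + 2 * (1 / eps) * f xstar) = eps * D + 2 * f xstar.
    by field; rewrite gt_eqF.
  have := mulr_ge0 (ltW eps0) D0; have := mulr_ge0 (ltW eps0) M0; lra.
move=> k; have J := time_average_Jensen hXconvex (hgconvex k) Xx tn0.
have S := dpp_queue_ge_sum dpp t k.
have QB := dpp_queue_bound V0 dpp (conj Xstar gstar) hD hmu hlagrange t.
(* By Jensen and [S], the average violation is at most [Q t k / t]. *)
suff Qt : Q t k <= t%:R * ((1 + 2 * D + 4 * M) * eps).
  by rewrite -(ler_pM2l t0) mulrDr; lra.
rewrite -ler_sqr ?nnegrE; last 2 first.
- exact: (dpp_queue_ge0 dpp).
- by rewrite !mulr_ge0 ?ltW//; lra.
have Qk : Q t k ^+ 2 <= \sum_(j < K) Q t j ^+ 2.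
  by rewrite (bigD1 k)//= lerDl sumr_ge0// => j _; exact: sqr_ge0.
apply: le_trans Qk _; apply: le_trans QB _.
set C := 1 + 2 * D + 4 * M in C0 *.
(* The last factor is at least 1 by [epst], so it is enough to stay below [t * C], which is at most
   [t * C ^+ 2]. *)
have -> : (t%:R * (C * eps)) ^+ 2 = t%:R * C ^+ 2 * (t%:R * eps ^+ 2) by ring.
have tC : t%:R * C <= t%:R * C ^+ 2.
  by rewrite ler_pM2l// expr2 ler_peMl// (le_trans ler01).
have : t%:R * C ^+ 2 <= t%:R * C ^+ 2 * (t%:R * eps ^+ 2).
  by rewrite ler_peMr// mulr_ge0 ?ltW// exprn_gt0// (lt_le_trans ltr01).
have := ler_wpM2r M0 Vt; rewrite -/M.
have : t%:R * C = t%:R + 2 * t%:R * D + 4 * (t%:R * M) by rewrite /C; ring.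
lra.
Qed.
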